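(* Let $G$ be a simple undirected graph. Then $G$ is a central max-point-tolerance graph if and only if $G$ is a unit max-tolerance graph.
   Context: Graphs are finite and simple; intervals are closed bounded intervals of the real line, and $|I|$ denotes the length of an interval $I$. A graph $G=(V,E)$ is a max-point-tolerance graph (MPTG) if one can assign to each $u\in V$ a pair $(I_u,p_u)$, where $I_u$ is an interval and $p_u\in I_u$ is a point, such that for distinct $u,v\in V$: $uv\in E$ if and only if $\{p_u,p_v\}\subseteq I_u\cap I_v$. It is a central max-point-tolerance graph (central MPTG) if such an assignment exists in which $p_u$ is the center (midpoint) of $I_u$ for every $u\in V$. A graph $G=(V,E)$ is a max-tolerance graph if one can assign to each $u\in V$ an interval $I_u$ and a positive real number $t_u$ (the tolerance of $u$) such that for distinct $u,v\in V$: $uv\in E$ if and only if $|I_u\cap I_v|\ge \max\{t_u,t_v\}$. It is a unit max-tolerance graph if such an assignment exists in which additionally $|I_u|=|I_v|$ for all $u,v\in V$. *)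

(* Defs.v *)
From HB Require Import structures.
From mathcomp Require Import all_boot all_order all_algebra.
From mathcomp Require Import all_classical all_reals all_analysis.

Set Implicit Arguments.
Unset Strict Implicit.
Unset Printing Implicit Defensive.

Import Order.TTheory GRing.Theory Num.Theory.
Import numFieldNormedType.Exports.

Local Open Scope classical_set_scope.
Local Open Scope ring_scope.

Record sgraph := SGraph {
  vertex :> finType;
  adj : rel vertex;
  adj_sym : symmetric adj;
  adj_irrefl : irreflexive adj
}.

(* Degenerate intervals [a, a] are allowed, the empty set is not. *)
Record closed_itv (R : realType) := ClosedItv {
  lo : R;
  hi : R;
  lo_le_hi : lo <= hi
}.

Definition set_of_closed_itv (R : realType) (I : closed_itv R) : set R :=
  `[lo I, hi I]%classic.

Coercion set_of_closed_itv : closed_itv >-> set.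

Definition midpoint (R : realType) (I : closed_itv R) : R :=
  (lo I + hi I) / 2.

(* The length of a set, not of a [closed_itv]: the intersection of two closed
   intervals may be empty, in which case its length is 0. *)
Definition length (R : realType) (A : set R) : \bar R :=
  @lebesgue_measure R A.

Definition mpt_representation (R : realType) (G : sgraph)
    (I : G -> closed_itv R) (p : G -> R) : Prop :=
  (forall u, (I u : set R) (p u)) /\
  (forall u v, u != v ->
     adj u v <-> [set p u; p v] `<=` I u `&` I v).

Definition central_mptg (R : realType) (G : sgraph) : Prop :=
  exists (I : G -> closed_itv R) (p : G -> R),
    mpt_representation I p /\ forall u, p u = midpoint (I u).

Definition max_tolerance_representation (R : realType) (G : sgraph)
    (I : G -> closed_itv R) (t : G -> R) : Prop :=
  (forall u, 0 < t u) /\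
  (forall u v, u != v ->
     adj u v <-> ((Num.max (t u) (t v))%:E <= length (I u `&` I v))%E).

Definition unit_max_tolerance (R : realType) (G : sgraph) : Prop :=
  exists (I : G -> closed_itv R) (t : G -> R),
    max_tolerance_representation I t /\
    forall u v, length (I u) = length (I v).

(* Main.v *)
(** Both kinds of representation amount to centers [c] and radii [r] such that
    distinct [u] and [v] are adjacent exactly when
    [`|c u - c v| <= min (r u) (r v)].
    For a central representation, [c u] and [r u] are the center and the
    half-length of the interval of [u], so that [r u >= 0].  For intervals of
    common length [L], the intersection has length [L - `|c u - c v|] when it is
    nondegenerate, and the tolerances correspond to the radii [r u = L - t u],
    possibly negative.  A vertex of negative radius is isolated, so it may be
    given radius 0 and moved to a private point away from all other centers. *)

Require Import Defs.
From mathcomp Require Import all_boot all_order all_algebra.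
From mathcomp Require Import all_classical all_reals all_analysis.
From mathcomp Require Import lra.

Set Implicit Arguments.
Unset Strict Implicit.
Unset Printing Implicit Defensive.

Import Order.TTheory GRing.Theory Num.Theory.

Local Open Scope classical_set_scope.
Local Open Scope ring_scope.

Definition radius_representation (R : realType) (G : sgraph) (c r : G -> R) :=
  forall u v : G, u != v ->
    adj u v <-> `|c u - c v| <= Num.min (r u) (r v).

(** Each midpoint lies in its own interval, so only membership in the other one matters: the
    distance between midpoints is at most that interval's half-length. *)
Lemma midpoints_mem_setI (R : realType) (I J : closed_itv R) :
  [set midpoint I; midpoint J] `<=` I `&` J <->
  `|midpoint I - midpoint J| <=
    Num.min ((hi I - lo I) / 2) ((hi J - lo J) / 2).
Proof.
have leI := lo_le_hi I; have leJ := lo_le_hi J.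
rewrite le_min !ler_norml /midpoint.
split.
  move=> sub.
  have /sub[_] : [set midpoint I; midpoint J] (midpoint I) by left.
  have /sub[+ _] : [set midpoint I; midpoint J] (midpoint J) by right.
  rewrite /set_of_closed_itv /midpoint /= !in_itv /=.
  by move=> /andP[? ?] /andP[? ?]; do ![apply/andP; split]; lra.
move=> /andP[/andP[? ?] /andP[? ?]] x.
by case=> ->; split; rewrite /set_of_closed_itv /midpoint /= in_itv /=;
  apply/andP; split; lra.
Qed.

Lemma length_closed_itv (R : realType) (I : closed_itv R) :
  length I = (hi I - lo I)%:E.
Proof.
rewrite /length /set_of_closed_itv lebesgue_measure_itv /= lte_fin.
case: ltP => // hi_le_lo.
have -> : hi I = lo I by apply/le_anti; rewrite hi_le_lo lo_le_hi.
by rewrite subrr.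
Qed.

(** The intersection runs from the larger left end to the smaller right end; for equal lengths, both
    ends come from the interval further right and further left respectively. *)
Lemma le_length_setI (R : realType) (I J : closed_itv R) (s : R) :
  0 < s -> length I = length J ->
  (s%:E <= length (I `&` J))%E <-> `|lo I - lo J| <= hi I - lo I - s.
Proof.
move=> s_gt0; rewrite !length_closed_itv => -[lenE].
have -> : (I `&` J : set R) =
    `[Num.max (lo I) (lo J), Num.min (hi I) (hi J)]%classic.
  apply/seteqP; split=> x; rewrite /set_of_closed_itv /= !in_itv /=
    ge_max le_min.
    by move=> [/andP[-> ->] /andP[-> ->]].
  by move=> /andP[/andP[-> ->] /andP[-> ->]].
have minBmax : Num.min (hi I) (hi J) - Num.max (lo I) (lo J) =
    hi I - lo I - `|lo I - lo J|.
  have [leIJ|ltJI] := leP (lo I) (lo J).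
    by rewrite min_l ?ler0_norm; lra.
  by rewrite min_r ?gtr0_norm; lra.
rewrite /length lebesgue_measure_itv /= lte_fin.
(* When the intersection is empty or a point, its length is 0 and [0 < s] makes both sides false. *)
case: ltP => [_|le_hi_lo]; first by rewrite -EFinB lee_fin minBmax; split; lra.
by rewrite lee_fin; split; lra.
Qed.

Lemma central_mptgP (R : realType) (G : sgraph) :
  central_mptg R G <->
  exists c r : G -> R, (forall u, 0 <= r u) /\ radius_representation c r.
Proof.
split.
  move=> [I [p [[_ adjP] p_mid]]].
  exists p, (fun u => (hi (I u) - lo (I u)) / 2); split=> [u|u v uv].
    by have := lo_le_hi (I u); lra.
  by rewrite adjP // !p_mid; exact: midpoints_mem_setI.
move=> [c [r [r_ge0 adjP]]].
have lo_le u : c u - r u <= c u + r u by have := r_ge0 u; lra.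
pose I u := ClosedItv (lo_le u).
have midE u : midpoint (I u) = c u by rewrite /midpoint /=; lra.
exists I, c; split=> //; split=> [u|u v uv].
  by rewrite /set_of_closed_itv /= in_itv /=; have := r_ge0 u;
    move=> ?; apply/andP; split; lra.
have := midpoints_mem_setI (I u) (I v); rewrite adjP // !midE /=.
have radE w : (c w + r w - (c w - r w)) / 2 = r w by lra.
by rewrite !radE => ->.
Qed.

Lemma unit_max_toleranceP (R : realType) (G : sgraph) :
  unit_max_tolerance R G <->
  exists c r : G -> R, radius_representation c r.
Proof.
split.
  move=> [I [t [[t_gt0 adjP] lenE]]].
  (* Left endpoints can replace midpoints: with a common length, they differ by a fixed
     translation. *)
  exists (fun u => lo (I u)), (fun u => hi (I u) - lo (I u) - t u) => u v uv.
  rewrite adjP // le_length_setI ?lt_max ?t_gt0 //.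
  have radE : hi (I v) - lo (I v) = hi (I u) - lo (I u).
    by have := lenE v u; rewrite !length_closed_itv => -[].
  rewrite radE le_min lerBrDr -lerBrDl ge_max.
  by split=> /andP[? ?]; apply/andP; split; lra.
move=> [c [r adjP]].
(* A common length above every radius, so that the tolerances [L - r u] are positive. *)
pose L := 1 + \sum_w `|r w|.
have r_lt u : r u < L.
  rewrite /L (bigD1 u) //=.
  have := ler_norm (r u).
  have : 0 <= \sum_(w | w != u) `|r w| by exact: sumr_ge0.
  lra.
have L_ge0 : 0 <= L by rewrite addr_ge0 // sumr_ge0.
have lo_le u : c u <= c u + L by rewrite lerDl.
pose I u := ClosedItv (lo_le u).
have lenE u v : length (I u) = length (I v).
  by rewrite !length_closed_itv /= ![_ + L]addrC !addrK.
exists I, (fun u => L - r u); split=> //; split=> [u|u v uv].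
  by rewrite subr_gt0.
rewrite adjP // le_length_setI ?lt_max ?subr_gt0 ?r_lt //=.
rewrite le_min [c u + L]addrC addrK lerBrDr -lerBrDl ge_max.
by split=> /andP[? ?]; apply/andP; split; lra.
Qed.

Lemma radius_representation_ge0 (R : realType) (G : sgraph) (c r : G -> R) :
  radius_representation c r ->
  exists c' r' : G -> R, (forall u, 0 <= r' u) /\ radius_representation c' r'.
Proof.
move=> adjP.
pose B := 1 + \sum_(w : G) `|c w|.
have c_lt u : c u < B.
  rewrite /B (bigD1 u) //= (le_lt_trans (ler_norm _)) //.
  have : 0 <= \sum_(w | w != u) `|c w| by exact: sumr_ge0.
  lra.
(* The rank separates the relocated centers from one another; [B] separates them from all the old
   ones. *)
pose far (u : G) : R := B + (enum_rank u)%:R.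
have far_ge u : B <= far u by rewrite /far lerDl.
have far_inj : injective far.
  by move=> u v /addrI/eqP; rewrite eqr_nat => /eqP/val_inj/enum_rank_inj.
pose c' u := if r u < 0 then far u else c u.
exists c', (fun u => Num.max 0 (r u)); split=> [u|u v uv].
  by rewrite le_max lexx.
have [ru|ru] := boolP ((r u < 0) || (r v < 0)); last first.
  move: ru; rewrite negb_or /c' -!leNgt => /andP[ru rv].
  rewrite !ltNge ru rv /= !max_r //; exact: adjP.
have c'_neq : c' u != c' v.
  move: ru; rewrite /c'; have := c_lt u; have := c_lt v.
  have := far_ge u; have := far_ge v.
  case: (r u < 0); case: (r v < 0) => //= *.
  - by rewrite (inj_eq far_inj).
  - by rewrite gt_eqF //; lra.
  - by rewrite lt_eqF //; lra.
(* Both sides are false here: the old bound on the distance is negative, and the new one is at most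
   0 while the new centers differ. *)
have min_lt0 : Num.min (r u) (r v) < 0 by rewrite gt_min.
have min_le0 : Num.min (Num.max 0 (r u)) (Num.max 0 (r v)) <= 0.
  by rewrite ge_min !ge_max lexx /=; case/orP: ru => /ltW ->; rewrite ?orbT.
split=> [/(adjP u v uv)|] h.
  by have := normr_ge0 (c u - c v); lra.
have := le_trans h min_le0.
by rewrite normr_le0 subr_eq0 (negbTE c'_neq).
Qed.

Theorem theorem3p2 (R : realType) (G : sgraph) :
  central_mptg R G <-> unit_max_tolerance R G.
Proof.
rewrite central_mptgP unit_max_toleranceP; split.
  by move=> [c [r [_ adjP]]]; exists c, r.
by move=> [c [r /radius_representation_ge0]].
Qed.
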